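(* Let $(A,d)$ and $(\bar A,\bar d)$ be connected cdga's over $\mathbb{C}$, of finite type in low degrees, and let $\mathfrak{g}$ be a complex Lie algebra. For each $i>1$ and for any representation $\theta\colon \mathfrak{g}\to \mathfrak{gl}(V)$ in a finite-dimensional non-zero $\mathbb{C}$-vector space $V$, $$\mathcal{R}^i_1(A\vee \bar{A}, \theta) = \big(\mathcal{R}^i_1(A, \theta) \times \mathcal{F}(\bar{A}, \mathfrak{g})\big) \cup \big(\mathcal{F}(A, \mathfrak{g}) \times \mathcal{R}^i_1(\bar{A}, \theta)\big).$$
   Context: A cdga $A=(A^\bullet,d)$ is a graded $\mathbb{C}$-algebra $A=\bigoplus_{i\ge 0}A^i$ (associative, unital, graded-commutative) with a differential $d\colon A^i\to A^{i+1}$, $d^2=0$, satisfying $d(ab)=da\cdot b+(-1)^i a\cdot db$ for $a\in A^i$. It is connected if $A^0=\mathbb{C}$. ''Of finite type in low degrees'' means: there is an integer $k\ge 1$ such that $A^i$ is finite-dimensional for all $i\le k$. The wedge sum $A\vee\bar A$ of two connected cdga's is the connected cdga with $(A\vee\bar A)^0=\mathbb{C}$ and $(A\vee\bar A)^i=A^i\oplus\bar A^i$ for $i>0$, with multiplication $(a,\bar a)\cdot(b,\bar b)=(ab,\bar a\bar b)$ in positive degrees and differential $D=d+\bar d$. For a Lie algebra $\mathfrak{g}$, $A\otimes\mathfrak{g}$ is a differential graded Lie algebra with bracket $[a\otimes x,b\otimes y]=ab\otimes[x,y]$ and differential $\partial(a\otimes x)=da\otimes x$. The set of flat $\mathfrak{g}$-valued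 connections is $\mathcal{F}(A,\mathfrak{g})=\{\omega\in A^1\otimes\mathfrak{g}\mid \partial\omega+\tfrac12[\omega,\omega]=0\}$. For $\omega=\sum_j\eta_j\otimes x_j\in\mathcal{F}(A,\mathfrak{g})$, the cochain complex $(A^\bullet\otimes V,d_\omega)$ has differential $d_\omega(\alpha\otimes v)=d\alpha\otimes v+\sum_j\eta_j\alpha\otimes\theta(x_j)(v)$. The resonance varieties are $\mathcal{R}^i_m(A,\theta)=\{\omega\in\mathcal{F}(A,\mathfrak{g})\mid \dim_{\mathbb{C}}H^i(A\otimes V,d_\omega)\ge m\}$. Since $(A\vee\bar A)^1=A^1\oplus\bar A^1$, one identifies $(A\vee\bar A)^1\otimes\mathfrak{g}$ with $(A^1\otimes\mathfrak{g})\times(\bar A^1\otimes\mathfrak{g})$, the pair $(\omega,\bar\omega)$ corresponding to $\omega+\bar\omega$; the equality is one of subsets of this space. *)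

(* Defs.v *)
From HB Require Import structures.
From mathcomp Require Import all_boot all_order all_algebra.
From mathcomp Require Import generic_quotient ring_quotient sesquilinear.
From mathcomp Require Import boolp classical_sets reals.
From mathcomp Require Import complex.

Set Implicit Arguments.
Unset Strict Implicit.
Unset Printing Implicit Defensive.

Import GRing.Theory.

Local Open Scope ring_scope.
Local Open Scope quotient_scope.

Section TensorQuotient.
Variables (K : fieldType) (M N : lmodType K).
Implicit Types (s t u : seq (M * N)) (a b : K).

(* A sequence [:: (m1, n1); ...; (mk, nk)] stands for the formal sum
   m1 (x) n1 + ... + mk (x) nk; tens_eq is the congruence on formal sums
   generated by the bilinearity relations. *)
Inductive tens_eq : seq (M * N) -> seq (M * N) -> Prop :=
| tens_eq_refl s : tens_eq s s
| tens_eq_sym s t : tens_eq s t -> tens_eq t s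
| tens_eq_trans s t u : tens_eq s t -> tens_eq t u -> tens_eq s u
| tens_eq_cat s s' t t' :
    tens_eq s s' -> tens_eq t t' -> tens_eq (s ++ t) (s' ++ t')
| tens_eq_catC s t : tens_eq (s ++ t) (t ++ s)
| tens_eq_0l n : tens_eq [:: (0, n)] [::]
| tens_eq_Dl m m' n : tens_eq [:: (m + m', n)] [:: (m, n); (m', n)]
| tens_eq_Dr m n n' : tens_eq [:: (m, n + n')] [:: (m, n); (m, n')]
| tens_eq_Z a m n : tens_eq [:: (a *: m, n)] [:: (m, a *: n)].

Definition tens_eqb s t : bool := `[< tens_eq s t >].

Lemma tens_eqb_refl : reflexive tens_eqb.
Proof. by move=> s; apply/asboolP; constructor. Qed.
Lemma tens_eqb_sym : symmetric tens_eqb.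
Proof. by move=> s t; apply/asboolP/asboolP => /tens_eq_sym. Qed.
Lemma tens_eqb_trans : transitive tens_eqb.
Proof.
by move=> t s u /asboolP st /asboolP tu; apply/asboolP/(tens_eq_trans st tu).
Qed.

Canonical tens_equiv := EquivRel tens_eqb tens_eqb_refl tens_eqb_sym tens_eqb_trans.
Canonical tens_equiv_direct := defaultEncModRel tens_eqb.

Definition tensor := {eq_quot tens_eqb}.
HB.instance Definition _ := Choice.on tensor.
HB.instance Definition _ := Quotient.on tensor.
HB.instance Definition _ : EqQuotient _ tens_eqb tensor := EqQuotient.on tensor.

Lemma tens_piP s t : reflect (tens_eq s t) (s == t %[mod tensor]).
Proof. by rewrite eqmodE; exact: asboolP. Qed.

Lemma tens_eq_pi s t : tens_eq s t -> \pi_tensor s = \pi_tensor t.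
Proof. by move=> ?; apply/eqP/tens_piP. Qed.

Lemma tens_eq_repr s : tens_eq (repr (\pi_tensor s)) s.
Proof. by apply/tens_piP; rewrite reprK. Qed.

Let scl a s := [seq (a *: p.1, p.2) | p <- s].

Let scl_eq a s t : tens_eq s t -> tens_eq (scl a s) (scl a t).
Proof.
elim=> {s t}.
- by move=> s; constructor.
- by move=> s t _; apply: tens_eq_sym.
- by move=> s t u _ st _ tu; apply: tens_eq_trans st tu.
- by move=> s s' t t' _ ? _ ?; rewrite /scl !map_cat; apply: tens_eq_cat.
- by move=> s t; rewrite /scl !map_cat; apply: tens_eq_catC.
- by move=> n; rewrite /scl /= scaler0; apply: tens_eq_0l.
- by move=> m m' n; rewrite /scl /= scalerDr; apply: tens_eq_Dl.
- by move=> m n n'; apply: tens_eq_Dr.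
- by move=> b m n; rewrite /scl /= scalerA mulrC -scalerA; apply: tens_eq_Z.
Qed.

Definition tensor_zero : tensor := \pi_tensor [::].
Definition tensor_add (x y : tensor) : tensor := \pi_tensor (repr x ++ repr y).
Definition tensor_scale a (x : tensor) : tensor :=
  \pi_tensor [seq (a *: p.1, p.2) | p <- repr x].
Definition tensor_opp (x : tensor) : tensor := tensor_scale (-1) x.

Let piD s t : tensor_add (\pi_tensor s) (\pi_tensor t) = \pi_tensor (s ++ t).
Proof. by apply: tens_eq_pi; apply: tens_eq_cat; apply: tens_eq_repr. Qed.

Let piZ a s : tensor_scale a (\pi_tensor s) = \pi_tensor (scl a s).
Proof. by apply: tens_eq_pi; apply: scl_eq; apply: tens_eq_repr. Qed.

Lemma tensor_addA : associative tensor_add.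
Proof.
by elim/quotW=> s; elim/quotW=> t; elim/quotW=> u; rewrite (piD t) (piD s t) !piD catA.
Qed.

Lemma tensor_addC : commutative tensor_add.
Proof.
elim/quotW=> s; elim/quotW=> t; rewrite !piD.
exact/tens_eq_pi/tens_eq_catC.
Qed.

Lemma tensor_add0 : left_id tensor_zero tensor_add.
Proof. by elim/quotW=> s; rewrite piD. Qed.

Lemma tensor_scaleDl x a b :
  tensor_scale (a + b) x = tensor_add (tensor_scale a x) (tensor_scale b x).
Proof.
elim/quotW: x => s; rewrite !piZ piD; apply: tens_eq_pi.
elim: s => [|[m n] s IHs] /=; first exact: tens_eq_refl.
rewrite -[_ :: _ ++ _]/([:: (a *: m, n)] ++ (scl a s ++ _)).
rewrite -[(b *: m, n) :: _]/([:: (b *: m, n)] ++ _).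
apply: (@tens_eq_trans _ ([:: (a *: m, n); (b *: m, n)] ++ (scl a s ++ scl b s))).
  by rewrite -cat1s; apply: tens_eq_cat => //; rewrite scalerDl; apply: tens_eq_Dl.
rewrite -[[:: _; _]]cat1s -!catA.
apply: tens_eq_cat; first exact: tens_eq_refl.
by rewrite !catA; apply: tens_eq_cat;
  [exact: tens_eq_catC|exact: tens_eq_refl].
Qed.

Let scale0 x : tensor_scale 0 x = tensor_zero.
Proof.
elim/quotW: x => s; rewrite piZ; apply: tens_eq_pi.
elim: s => [|[m n] s IHs] /=; first exact: tens_eq_refl.
by rewrite scale0r -cat1s -[[::]]cats0; apply: tens_eq_cat => //; apply: tens_eq_0l.
Qed.

Let scale1 : left_id 1 tensor_scale.
Proof.
elim/quotW=> s; rewrite piZ /scl; congr (\pi_tensor _).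
by rewrite -[RHS]map_id; apply: eq_map => -[m n] /=; rewrite scale1r.
Qed.

Lemma tensor_addN : left_inverse tensor_zero tensor_opp tensor_add.
Proof.
by move=> x; rewrite -{2}[x]scale1 -tensor_scaleDl addNr scale0.
Qed.

HB.instance Definition _ :=
  GRing.isZmodule.Build tensor tensor_addA tensor_addC tensor_add0 tensor_addN.

Lemma tensor_scaleA a b x :
  tensor_scale a (tensor_scale b x) = tensor_scale (a * b) x.
Proof.
elim/quotW: x => s; rewrite (piZ b) !piZ /scl -map_comp; congr (\pi_tensor _).
by apply: eq_map => p /=; rewrite scalerA.
Qed.

Lemma tensor_scaleDr : right_distributive tensor_scale +%R.
Proof.
move=> a; elim/quotW=> s; elim/quotW=> t.
by rewrite -[_ + _]/(tensor_add _ _) piD !piZ -[_ + _]/(tensor_add _ _) piD /scl map_cat.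
Qed.

Lemma tensor_scaleDl' x : {morph tensor_scale^~ x : a b / a + b}.
Proof. by move=> a b; apply: tensor_scaleDl. Qed.

HB.instance Definition _ := GRing.Zmodule_isLmodule.Build K tensor
  tensor_scaleA scale1 tensor_scaleDr tensor_scaleDl'.

Definition tens (m : M) (n : N) : tensor := \pi_tensor [:: (m, n)].

Lemma tens_is_bilinear : bilinear_for *:%R *:%R tens.
Proof.
split=> [n a m m'|m a n n'] /=.
  rewrite /tens; transitivity (\pi_tensor [:: (a *: m, n); (m', n)]).
    exact/tens_eq_pi/tens_eq_Dl.
  exact: etrans (esym (piD [:: (a *: m, n)] [:: (m', n)]))
    (congr1 (tensor_add^~ _) (esym (piZ a [:: (m, n)]))).
rewrite /tens; transitivity (\pi_tensor [:: (m, a *: n); (m, n')]).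
  exact/tens_eq_pi/tens_eq_Dr.
transitivity (\pi_tensor ([:: (a *: m, n)] ++ [:: (m, n')])).
  apply: tens_eq_pi; rewrite -cat1s; apply: tens_eq_cat.
    exact/tens_eq_sym/tens_eq_Z.
  exact: tens_eq_refl.
exact: etrans (esym (piD [:: (a *: m, n)] [:: (m, n')]))
  (congr1 (tensor_add^~ _) (esym (piZ a [:: (m, n)]))).
Qed.
HB.instance Definition _ := bilinear_isBilinear.Build K M N tensor
  *:%R *:%R tens tens_is_bilinear.

Lemma tensorE (x : tensor) : x = \sum_(p <- repr x) tens p.1 p.2.
Proof.
rewrite -{1}[x]reprK; elim: (repr x) => [|[m n] s IHs]; first by rewrite big_nil.
by rewrite big_cons -IHs; exact: esym (piD [:: (m, n)] s).
Qed.

End TensorQuotient.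

Arguments tensor {K} M N.

Section TensorLift.
Variables (K : fieldType) (M N P : lmodType K).

Definition tens_lift (f : {bilinear M -> N -> P}) (x : tensor M N) : P :=
  \sum_(p <- repr x) f p.1 p.2.

Variable f : {bilinear M -> N -> P}.

Let lift_eq (s t : seq (M * N)) :
  tens_eq s t -> \sum_(p <- s) f p.1 p.2 = \sum_(p <- t) f p.1 p.2.
Proof.
elim=> {s t} //=.
- by move=> s t u _ -> _ ->.
- by move=> s s' t t' _ e _ e'; rewrite !big_cat /= e e'.
- by move=> s t; rewrite !big_cat /= addrC.
- by move=> n; rewrite big_seq1 big_nil linear0l.
- by move=> m m' n; rewrite big_seq1 big_cons big_seq1 linearDl.
- by move=> m n n'; rewrite big_seq1 big_cons big_seq1 linearDr.
- by move=> a m n; rewrite !big_seq1 linearZl_LR linearZr_LR.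
Qed.

Lemma tens_lift_is_linear : linear (tens_lift f).
Proof.
move=> a x y; rewrite /tens_lift.
rewrite -[_ *: _ + _]/(tensor_add (tensor_scale a x) y).
rewrite (lift_eq (tens_eq_repr _)) big_cat /=; congr (_ + _).
rewrite (lift_eq (tens_eq_repr _)) big_map scaler_sumr.
by apply: eq_bigr => p _ /=; rewrite linearZl_LR.
Qed.
HB.instance Definition _ :=
  GRing.isLinear.Build K (tensor M N) P *:%R (tens_lift f) tens_lift_is_linear.

Lemma tens_liftE m n : tens_lift f (tens m n) = f m n.
Proof. by rewrite /tens_lift (lift_eq (tens_eq_repr _)) big_seq1. Qed.

Lemma tens_ext (g h : {linear tensor M N -> P}) :
  (forall m n, g (tens m n) = h (tens m n)) -> g =1 h.
Proof.
by move=> gh x; rewrite [x]tensorE !linear_sum; apply: eq_bigr => p _.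
Qed.

End TensorLift.


Section Cohomology.
Variables (K : fieldType) (X : nat -> lmodType K).
Variable d : forall i, {linear X i -> X i.+1}.

Definition cocycle_pred (i : nat) : {pred X i} := [pred x | d i x == 0].
Arguments cocycle_pred : clear implicits.

Lemma cocycle_submod i : submod_closed (cocycle_pred i).
Proof.
split=> [|a x y]; first by rewrite inE linear0.
by rewrite !inE => /eqP dx /eqP dy; rewrite linearP dx dy scaler0 addr0.
Qed.
HB.instance Definition _ i :=
  GRing.isSubmodClosed.Build K (X i) (cocycle_pred i) (cocycle_submod i).

Definition cocycle (i : nat) : Type := {x : X i | x \in cocycle_pred i}.
HB.instance Definition _ i := [isSub of cocycle i for @sval _ _].
HB.instance Definition _ i := [Choice of cocycle i by <:].
HB.instance Definition _ i := [SubChoice_isSubLmodule of cocycle i by <:].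

Definition is_coboundary (i : nat) : X i -> Prop :=
  match i with
  | 0 => fun x => x = 0
  | j.+1 => fun x => exists y : X j, d j y = x
  end.

Definition coboundary_pred (i : nat) : {pred cocycle i} :=
  [pred z | `[< is_coboundary (val z) >]].
Arguments coboundary_pred : clear implicits.

Lemma coboundary_submod i : submod_closed (coboundary_pred i).
Proof.
split=> [|a x y].
  apply/asboolP; rewrite linear0; case: i => [|i] //=.
  by exists 0; rewrite linear0.
move=> /asboolP bx /asboolP by_; apply/asboolP; rewrite linearP.
case: i x y bx by_ => [|i] x y /=; first by move=> -> ->; rewrite scaler0 addr0.
by move=> [x' <-] [y' <-]; exists (a *: x' + y'); rewrite linearP.
Qed.
HB.instance Definition _ i := GRing.isSubmodClosed.Build K (cocycle i)
  (coboundary_pred i) (coboundary_submod i).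

(* The coboundaries are taken inside the space of cocycles, so that this is the
   quotient Z^i / (Z^i :&: B^i); it is Z^i / B^i as soon as d squares to zero,
   which for the differential twisted by a flat connection is twisted_diffK
   below. *)
Definition cohomology (i : nat) : Type := Quotient.quot (coboundary_pred i).
HB.instance Definition _ i := GRing.Zmodule.on (cohomology i).
HB.instance Definition _ i := Quotient.on (cohomology i).

Section Scale.
Variable i : nat.
Local Notation H := (cohomology i).
Definition coho_scale (a : K) (h : H) : H := \pi_H (a *: repr h).

Lemma coho_pi_scale a (z : cocycle i) : coho_scale a (\pi_H z) = \pi_H (a *: z).
Proof.
apply/eqP; rewrite -Quotient.idealrBE -scalerBr.
by apply: rpredZ; rewrite Quotient.idealrBE reprK.
Qed.

Lemma coho_scaleA a b h : coho_scale a (coho_scale b h) = coho_scale (a * b) h.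
Proof.
by elim/quotW: h => z; rewrite (coho_pi_scale b) !coho_pi_scale scalerA.
Qed.

Lemma coho_scale1 : left_id 1 coho_scale.
Proof. by elim/quotW=> z; rewrite coho_pi_scale scale1r. Qed.

Lemma coho_piD (x y : cocycle i) : \pi_H x + \pi_H y = \pi_H (x + y).
Proof. by rewrite -[LHS]Quotient.pi_add. Qed.

Lemma coho_scaleDr : right_distributive coho_scale +%R.
Proof.
move=> a; elim/quotW=> x; elim/quotW=> y.
by rewrite coho_piD (coho_pi_scale a x) (coho_pi_scale a y) coho_pi_scale
  scalerDr coho_piD.
Qed.

Lemma coho_scaleDl h : {morph coho_scale^~ h : a b / a + b}.
Proof.
elim/quotW: h => z a b /=.
by rewrite (coho_pi_scale a) (coho_pi_scale b) coho_pi_scale coho_piD scalerDl.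
Qed.

HB.instance Definition _ := GRing.Zmodule_isLmodule.Build K H
  coho_scaleA coho_scale1 coho_scaleDr coho_scaleDl.

End Scale.
End Cohomology.

Arguments cohomology {K X} d i.

(* dim M >= m, also meaningful when M is infinite-dimensional. *)
Definition dim_ge (K : fieldType) (M : lmodType K) (m : nat) : Prop :=
  exists e : 'I_m -> M,
    forall c : 'I_m -> K, \sum_j c j *: e j = 0 -> forall j, c j = 0.

Definition fin_dim (K : fieldType) (M : lmodType K) : Prop :=
  exists (n : nat) (e : 'I_n -> M),
    forall x : M, exists c : 'I_n -> K, x = \sum_j c j *: e j.

Definition gcast (K : fieldType) (X : nat -> lmodType K) (i j : nat)
    (e : i = j) (x : X i) : X j := eq_rect i (fun n => X n : Type) x j e.
Arguments gcast {K} X {i j} e x.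

(* The graded pieces are kept as separate spaces, so an identity relating
   elements of A^m and A^n, where m and n are equal but not convertible, is
   stated through gcast. *)
Record cdga (K : fieldType) := Cdga {
  deg :> nat -> lmodType K;
  cmul : forall i j, {bilinear deg i -> deg j -> deg (i + j)};
  cone : deg 0;
  cdiff : forall i, {linear deg i -> deg i.+1};
  cmulA : forall i j k (a : deg i) (b : deg j) (c : deg k),
    gcast deg (addnA i j k) (cmul i (j + k) a (cmul j k b c)) =
    cmul (i + j) k (cmul i j a b) c;
  cmul1l : forall i (a : deg i), cmul 0 i cone a = a;
  cmul1r : forall i (a : deg i), gcast deg (addn0 i) (cmul i 0 a cone) = a;
  cmulC : forall i j (a : deg i) (b : deg j),
    cmul i j a b = (-1) ^+ (i * j) *: gcast deg (addnC j i) (cmul j i b a);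
  cdiffK : forall i (a : deg i), cdiff i.+1 (cdiff i a) = 0;
  cdiffM : forall i j (a : deg i) (b : deg j),
    cdiff (i + j) (cmul i j a b) =
    cmul i.+1 j (cdiff i a) b
      + (-1) ^+ i *: gcast deg (addnS i j) (cmul i j.+1 a (cdiff j b))
}.

Arguments cmul {K A i j} : rename.
Arguments cone {K A} : rename.
Arguments cdiff {K A i} : rename.

Definition connected (K : fieldType) (A : cdga K) : Prop :=
  cone != 0 :> A 0%N /\ forall a : A 0%N, exists c : K, a = c *: cone.

Definition finite_type_low (K : fieldType) (A : cdga K) : Prop :=
  exists2 k : nat, (1 <= k)%N & forall i, (i <= k)%N -> fin_dim (A i).

Record lieAlgebra (K : fieldType) := LieAlgebra {
  lie_space :> lmodType K;
  lie_bracket : {bilinear lie_space -> lie_space -> lie_space};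
  lie_alternating : forall x, lie_bracket x x = 0;
  lie_jacobi : forall x y z,
    lie_bracket x (lie_bracket y z) + lie_bracket y (lie_bracket z x)
      + lie_bracket z (lie_bracket x y) = 0
}.

Arguments lie_bracket {K g} : rename.

Record lieRep (K : fieldType) (g : lieAlgebra K) (V : vectType K) := LieRep {
  rep_map :> {linear g -> 'End(V)};
  rep_bracket : forall x y : g,
    rep_map (lie_bracket x y) =
    (rep_map x \o rep_map y)%VF - (rep_map y \o rep_map x)%VF
}.

Section Wedge.
Variables (K : fieldType) (A B : cdga K).

(* Degree 0 of the wedge is K itself: the spaces A^0 and B^0 are not used, hence
   the case analysis on degrees below. *)
Definition wedge_deg (i : nat) : lmodType K :=
  match i with
  | 0 => K^o
  | j.+1 => (A j.+1 * B j.+1)%type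
  end.

Definition wedge_mul (i j : nat) : wedge_deg i -> wedge_deg j -> wedge_deg (i + j) :=
  match i, j return wedge_deg i -> wedge_deg j -> wedge_deg (i + j) with
  | 0, _ => fun c y => (c : K) *: y
  | i'.+1, 0 => fun x c =>
      (c : K) *: gcast wedge_deg (esym (addn0 i'.+1)) x
  | i'.+1, j'.+1 => fun x y => (cmul x.1 y.1, cmul x.2 y.2)
  end.

Definition wedge_diff (i : nat) : wedge_deg i -> wedge_deg i.+1 :=
  match i return wedge_deg i -> wedge_deg i.+1 with
  | 0 => fun=> 0
  | j.+1 => fun x => (cdiff x.1, cdiff x.2)
  end.


Local Notation W := wedge_deg.

Let gcastS (i j : nat) (e : i.+1 = j.+1) (x : W i.+1) :
  gcast W e x = (gcast A e x.1, gcast B e x.2).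
Proof.
have e' : i = j by case: e.
by case: _ / e' e => e; rewrite (eq_irrelevance e erefl) /=; case: x.
Qed.

Let gcast_id (X : nat -> lmodType K) i (e : i = i) (x : X i) : gcast X e x = x.
Proof. by rewrite (eq_irrelevance e erefl). Qed.

Let gcastK (X : nat -> lmodType K) i j k (e : i = j) (e' : j = k) (x : X i) :
  gcast X e' (gcast X e x) = gcast X (etrans e e') x.
Proof. by case: _ / e'. Qed.

Let gcastZ (X : nat -> lmodType K) i j (e : i = j) a (x : X i) :
  gcast X e (a *: x) = a *: gcast X e x.
Proof. by case: _ / e. Qed.

Let gcastP (X : nat -> lmodType K) i j (e : i = j) a (x y : X i) :
  gcast X e (a *: x + y) = a *: gcast X e x + gcast X e y.
Proof. by case: _ / e. Qed.

Lemma wedge_mul_is_bilinear i j : bilinear_for *:%R *:%R (@wedge_mul i j).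
Proof.
case: i j => [|i] [|j]; split=> [u a x y|u a x y] /=.
- by rewrite scalerDl scalerA.
- by rewrite scalerDr !scalerA mulrC.
- by rewrite scalerDl scalerA.
- by rewrite scalerDr !scalerA mulrC.
- by rewrite gcastP scalerDr !scalerA mulrC.
- by rewrite scalerDl scalerA.
- by rewrite !linearPl.
- by rewrite !linearPr.
Qed.
HB.instance Definition _ i j := bilinear_isBilinear.Build K (W i) (W j) (W (i + j))
  *:%R *:%R (@wedge_mul i j) (wedge_mul_is_bilinear i j).

Lemma wedge_diff_is_linear i : linear (@wedge_diff i).
Proof.
case: i => [|i] a x y /=; first by rewrite scaler0 addr0.
by rewrite !linearP.
Qed.
HB.instance Definition _ i := GRing.isLinear.Build K (W i) (W i.+1) *:%R
  (@wedge_diff i) (@wedge_diff_is_linear i).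

Let mulZl i j c (a : W i) (b : W j) : wedge_mul (c *: a) b = c *: wedge_mul a b.
Proof. exact: linearZl_LR. Qed.

Let mulZr i j c (a : W i) (b : W j) : wedge_mul a (c *: b) = c *: wedge_mul a b.
Proof. exact: linearZr_LR. Qed.

Let diffZ i c (a : W i) : wedge_diff (c *: a) = c *: wedge_diff a.
Proof. exact: linearZ_LR. Qed.

Let gcast_0 (X : nat -> lmodType K) i j (e : i = j) : gcast X e 0 = 0.
Proof. by case: _ / e. Qed.

Let gcast_irr (X : nat -> lmodType K) i j (e e' : i = j) (x : X i) :
  gcast X e x = gcast X e' x.
Proof. by rewrite (eq_irrelevance e e'). Qed.

Let gcast_mull i i' j (e : i = i') (e' : i + j = i' + j) (a : W i) (b : W j) :
  wedge_mul (gcast W e a) b = gcast W e' (wedge_mul a b).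
Proof. by case: _ / e e' => e'; rewrite gcast_id. Qed.

Let gcast_mulr i j j' (e : j = j') (e' : i + j = i + j') (a : W i) (b : W j) :
  wedge_mul a (gcast W e b) = gcast W e' (wedge_mul a b).
Proof. by case: _ / e e' => e'; rewrite gcast_id. Qed.

Let gcast_diff i j (e : i = j) (e' : i.+1 = j.+1) (a : W i) :
  wedge_diff (gcast W e a) = gcast W e' (wedge_diff a).
Proof. by case: _ / e e' => e'; rewrite gcast_id. Qed.

Lemma wedge_mulA i j k (a : W i) (b : W j) (c : W k) :
  gcast W (addnA i j k) (wedge_mul a (wedge_mul b c)) =
  wedge_mul (wedge_mul a b) c.
Proof.
case: i a => [|i] a; first by rewrite gcast_id; apply: esym (mulZl _ _ _).
case: j b => [|j] b.
  rewrite [wedge_mul b c]/= [wedge_mul a b]/= mulZr mulZl gcastZ.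
  congr (_ *: _); rewrite (gcast_mull _ (addnA i.+1 0%N k)).
  exact: gcast_irr.
case: k c => [|k] c.
  rewrite [wedge_mul b c]/= [RHS]/= mulZr gcastZ; congr (_ *: _).
  rewrite (gcast_mulr _ (congr1 (addn i.+1) (esym (addn0 j.+1)))) gcastK.
  exact: gcast_irr.
rewrite gcastS; congr (_, _).
  exact: etrans (gcast_irr (X := A) _ _ _) (cmulA a.1 b.1 c.1).
exact: etrans (gcast_irr (X := B) _ _ _) (cmulA a.2 b.2 c.2).
Qed.

Lemma wedge_mul1l i (a : W i) : wedge_mul (1 : W 0%N) a = a.
Proof. by rewrite /= scale1r. Qed.

Lemma wedge_mul1r i (a : W i) : gcast W (addn0 i) (wedge_mul a (1 : W 0%N)) = a.
Proof.
case: i a => [|i] a /=; rewrite ?gcastZ ?gcastK gcast_id; last by rewrite scale1r.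
exact: mulr1.
Qed.

Lemma wedge_mulC i j (a : W i) (b : W j) :
  wedge_mul a b = (-1) ^+ (i * j) *: gcast W (addnC j i) (wedge_mul b a).
Proof.
case: i j a b => [|i] [|j] a b.
- by rewrite expr0 scale1r gcast_id; apply: mulrC.
- by rewrite expr0 scale1r /= gcastZ gcastK gcast_id.
- rewrite muln0 expr0 scale1r /= gcastZ; congr (_ *: _).
  exact (@gcast_irr W i.+1 (i.+1 + 0)%N _ (addnC 0%N i.+1) a).
rewrite gcastS /= cmulC [cmul a.2 _]cmulC; by congr (_ *: _, _ *: _); exact: gcast_irr.
Qed.

Lemma wedge_diffK i (a : W i) : wedge_diff (wedge_diff a) = 0.
Proof. by case: i a => [|i] a /=; rewrite ?linear0 ?cdiffK. Qed.

Lemma wedge_diffM i j (a : W i) (b : W j) :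
  wedge_diff (wedge_mul a b) = wedge_mul (wedge_diff a) b
    + (-1) ^+ i *: gcast W (addnS i j) (wedge_mul a (wedge_diff b)).
Proof.
have mul0l k l (y : W l) : wedge_mul (0 : W k) y = 0 by exact: linear0l.
have mul0r k l (x : W k) : wedge_mul x (0 : W l) = 0 by exact: linear0r.
case: i a => [|i] a.
  rewrite mul0l add0r expr0 scale1r gcast_id; exact: linearZ_LR.
case: j b => [|j] b.
  rewrite mul0r gcast_0 scaler0 addr0 [wedge_mul a b]/= diffZ.
  rewrite (gcast_diff _ (congr1 S (esym (addn0 i.+1)))); congr (_ *: _).
  exact: gcast_irr.
rewrite gcastS; congr (_, _).
  apply: etrans (cdiffM a.1 b.1) _; congr (_ + _ *: _); exact: gcast_irr.
apply: etrans (cdiffM a.2 b.2) _; congr (_ + _ *: _); exact: gcast_irr.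
Qed.

Definition wedge : cdga K := Cdga (deg := W) (cmul := fun i j => @wedge_mul i j)
  (cdiff := fun i => @wedge_diff i)
  wedge_mulA wedge_mul1l wedge_mul1r wedge_mulC wedge_diffK wedge_diffM.

End Wedge.

Section TensorMap.
Variables (K : fieldType) (M M' N N' : lmodType K).
Variables (f : {linear M -> M'}) (h : {linear N -> N'}).

Definition tens_map_pure (m : M) (n : N) : tensor M' N' := tens (f m) (h n).

Lemma tens_map_pure_bilinear : bilinear_for *:%R *:%R tens_map_pure.
Proof.
by split=> [u a x y|u a x y]; rewrite /tens_map_pure linearP ?linearPl ?linearPr.
Qed.
HB.instance Definition _ := bilinear_isBilinear.Build K M N (tensor M' N')
  *:%R *:%R tens_map_pure tens_map_pure_bilinear.

Definition tens_map : tensor M N -> tensor M' N' := tens_lift tens_map_pure.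
HB.instance Definition _ := GRing.Linear.on tens_map.

Lemma tens_mapE m n : tens_map (tens m n) = tens (f m) (h n).
Proof. exact: tens_liftE. Qed.

End TensorMap.

Lemma tens_lift_linP (K : fieldType) (M N P : lmodType K)
    (f f1 f2 : {bilinear M -> N -> P}) (a : K) (x : tensor M N) :
  (forall m n, f m n = a *: f1 m n + f2 m n) ->
  tens_lift f x = a *: tens_lift f1 x + tens_lift f2 x.
Proof.
move=> E; rewrite /tens_lift scaler_sumr -big_split.
by apply: eq_bigr => p _; rewrite E.
Qed.

Section Connections.
Variables (K : fieldType) (A : cdga K) (g : lieAlgebra K).

Definition conn_diff (i : nat) : tensor (A i) g -> tensor (A i.+1) g :=
  tens_map (cdiff : {linear A i -> A i.+1}) idfun.
HB.instance Definition _ i := GRing.Linear.on (@conn_diff i).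

Section Bracket.
Variables i j : nat.
Local Notation T := (tensor (A (i + j)%N) g).

Definition bracket_pure (a : A i) (x : g) (b : A j) (y : g) : T :=
  tens (cmul a b) (lie_bracket x y).

Lemma bracket_pure_bilinear a x : bilinear_for *:%R *:%R (bracket_pure a x).
Proof.
by split=> [u c y z|u c y z]; rewrite /bracket_pure linearPr ?linearPl ?linearPr.
Qed.
HB.instance Definition _ a x := bilinear_isBilinear.Build K (A j) g T
  *:%R *:%R (bracket_pure a x) (bracket_pure_bilinear a x).

Definition bracket_left (t : tensor (A j) g) (a : A i) (x : g) : T :=
  tens_lift (bracket_pure a x) t.

Lemma bracket_left_bilinear t : bilinear_for *:%R *:%R (bracket_left t).
Proof.
split=> [x c a b|a c x y]; apply: tens_lift_linP => b' y' /=;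
  by rewrite /bracket_pure linearPl ?linearPl ?linearPr.
Qed.
HB.instance Definition _ t := bilinear_isBilinear.Build K (A i) g T
  *:%R *:%R (bracket_left t) (bracket_left_bilinear t).

Definition conn_bracket (s : tensor (A i) g) (t : tensor (A j) g) : T :=
  tens_lift (bracket_left t) s.

Lemma conn_bracketE a x b y :
  conn_bracket (tens a x) (tens b y) = tens (cmul a b) (lie_bracket x y).
Proof. by rewrite /conn_bracket tens_liftE /= /bracket_left tens_liftE. Qed.

Lemma conn_bracket_bilinear : bilinear_for *:%R *:%R conn_bracket.
Proof.
split=> [t c s s'|s c t t']; first exact: linearP.
by apply: tens_lift_linP => a x; apply: linearP.
Qed.
HB.instance Definition _ := bilinear_isBilinear.Build K
  (tensor (A i) g) (tensor (A j) g) T *:%R *:%R conn_bracket conn_bracket_bilinear.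

End Bracket.

Definition flat_connections : set (tensor (A 1%N) g) :=
  [set w : tensor (A 1%N) g |
    conn_diff w + 2^-1 *: (conn_bracket w w : tensor (A 2%N) g) = 0]%classic.

Variables (V : vectType K) (theta : lieRep g V).

Section Action.
Variables (j i : nat) (alpha : A i) (v : V).

Definition action_pure (eta : A j) (x : g) : tensor (A (j + i)%N) V :=
  tens (cmul eta alpha) (theta x v).

Lemma action_pure_bilinear : bilinear_for *:%R *:%R action_pure.
Proof.
split=> [x c a b|a c x y] /=; first by rewrite /action_pure !linearPl.
by rewrite /action_pure linearP add_lfunE scale_lfunE linearPr.
Qed.
HB.instance Definition _ := bilinear_isBilinear.Build K (A j) g
  (tensor (A (j + i)%N) V) *:%R *:%R action_pure action_pure_bilinear.

End Action.
Arguments action_pure j {i} alpha v eta x.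

Section Twisted.
Variables (w : tensor (A 1%N) g) (i : nat).

Definition twisted_pure (alpha : A i) (v : V) : tensor (A i.+1) V :=
  tens (cdiff alpha) v + (tens_lift (action_pure 1 alpha v) w : tensor (A i.+1) V).

Lemma twisted_pure_bilinear : bilinear_for *:%R *:%R twisted_pure.
Proof.
split=> [v c a b|a c v v'] /=; rewrite /twisted_pure.
  rewrite (@tens_lift_linP _ _ _ _ _ (action_pure 1 a v) (action_pure 1 b v) c).
    by rewrite linearP linearPl scalerDr addrACA.
  by move=> eta x /=; rewrite /action_pure linearPr linearPl.
rewrite (@tens_lift_linP _ _ _ _ _ (action_pure 1 a v) (action_pure 1 a v') c).
  by rewrite linearPr scalerDr addrACA.
by move=> eta x /=; rewrite /action_pure linearP linearPr.
Qed.
HB.instance Definition _ := bilinear_isBilinear.Build K (A i) V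
  (tensor (A i.+1) V) *:%R *:%R twisted_pure twisted_pure_bilinear.

Definition twisted_diff : tensor (A i) V -> tensor (A i.+1) V :=
  tens_lift twisted_pure.
HB.instance Definition _ := GRing.Linear.on twisted_diff.

End Twisted.

Lemma twisted_diffE (w : tensor (A 1%N) g) (r : seq (A 1%N * g)) i (alpha : A i) (v : V) :
  w = \sum_(p <- r) tens p.1 p.2 ->
  twisted_diff w (tens alpha v) =
  tens (cdiff alpha) v
    + \sum_(p <- r) (tens (cmul p.1 alpha) (theta p.2 v) : tensor (A i.+1) V).
Proof.
move=> ->; rewrite /twisted_diff tens_liftE /= /twisted_pure linear_sum.
by congr (_ + _); apply: eq_bigr => p _; apply: tens_liftE.
Qed.

Lemma twisted_diffK (w : tensor (A 1%N) g) i (y : tensor (A i) V) :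
  2 != 0 :> K -> flat_connections w -> twisted_diff w (twisted_diff w y) = 0.
Proof.
move=> two_neq0 flat_w.
apply: (tens_ext (g := @twisted_diff w i.+1 \o @twisted_diff w i) (h := \0)).
move=> alpha v; rewrite /comp [RHS]/=.
have Ew := tensorE w; move: (repr w) Ew => r Ew.
pose c2 : {linear tensor (A 2%N) g -> tensor (A i.+2) V} :=
  tens_lift (action_pure 2 alpha v).
have c2E (a : A 2%N) x : c2 (tens a x) = tens (cmul a alpha) (theta x v).
  exact: tens_liftE.
pose S : tensor (A i.+2) V := \sum_(p <- r) \sum_(q <- r)
  tens (cmul q.1 (cmul p.1 alpha)) (theta q.2 (theta p.2 v)).
pose D : tensor (A i.+2) V := \sum_(p <- r) tens (cmul (cdiff p.1) alpha) (theta p.2 v).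
have c2d : c2 (conn_diff w) = D.
  rewrite /D Ew (linear_sum (@conn_diff 1)) (linear_sum c2); apply: eq_bigr => p _.
  by rewrite -c2E; congr (c2 _); apply: tens_mapE.
have mulA1 (a b : A 1%N) : cmul (cmul a b : A 2%N) alpha = cmul a (cmul b alpha) :> A i.+2.
  by rewrite -[LHS]cmulA /gcast (eq_irrelevance (addnA 1%N 1%N i) erefl).
have mulC1 (a b : A 1%N) : cmul a b = - cmul b a :> A 2%N.
  by rewrite [LHS]cmulC /gcast (eq_irrelevance (addnC 1%N 1%N) erefl) expr1 scaleN1r.
have c2b : c2 (conn_bracket w w) = 2 *: S.
  transitivity (\sum_(p <- r) \sum_(q <- r)
     c2 (tens (cmul p.1 q.1) (lie_bracket p.2 q.2))).
    rewrite {1}Ew [X in c2 X]linear_sumlz (linear_sum c2); apply: eq_bigr => p _.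
    rewrite {1}Ew [X in c2 X]linear_sumr (linear_sum c2); apply: eq_bigr => q _.
    by rewrite /= conn_bracketE.
  pose s (p q : A 1%N * g) : tensor (A i.+2) V :=
    tens (cmul q.1 (cmul p.1 alpha)) (theta q.2 (theta p.2 v)).
  transitivity (\sum_(p <- r) \sum_(q <- r) (s q p + s p q)).
    apply: eq_bigr => p _; apply: eq_bigr => q _.
    rewrite c2E rep_bracket add_lfunE opp_lfunE !comp_lfunE linearDr linearNr.
    congr (_ + _); first by rewrite mulA1.
    by rewrite mulC1 linearNl linearNl opprK mulA1.
  under eq_bigr do rewrite big_split.
  by rewrite big_split /= exchange_big -mulr2n scaler_nat.
have dS : D + S = 0.
  move: (congr1 c2 flat_w).
  by rewrite linearD linearZ /= c2d c2b linear0 scalerA mulVf // scale1r.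
transitivity (twisted_diff w (tens (cdiff alpha) v) +
    \sum_(p <- r) twisted_diff w (tens (cmul p.1 alpha : A i.+1) (theta p.2 v))).
  rewrite -(linear_sum (@twisted_diff w i.+1)) -(linearD (@twisted_diff w i.+1)).
  congr (twisted_diff w _); exact: twisted_diffE Ew.
rewrite (twisted_diffE _ _ Ew) cdiffK linear0l add0r.
under [X in _ + X]eq_bigr => p _ do rewrite (twisted_diffE _ _ Ew).
rewrite big_split addrA -[RHS]dS; congr (_ + _).
rewrite -big_split; apply: eq_bigr => p _ /=.
rewrite -linearDl; congr tens.
have -> : cdiff (cmul p.1 alpha) =
    cmul (cdiff p.1) alpha - cmul p.1 (cdiff alpha) :> A i.+2.
  rewrite [LHS]cdiffM /gcast (eq_irrelevance (addnS 1%N i) erefl).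
  by rewrite expr1 scaleN1r.
by rewrite addrC subrK.
Qed.

Definition resonance (i m : nat) : set (tensor (A 1%N) g) :=
  [set w : tensor (A 1%N) g | flat_connections w /\
           dim_ge (cohomology (fun n => @twisted_diff w n : {linear _ -> _}) i) m]%classic.

End Connections.

Arguments flat_connections {K} A g.
Arguments resonance {K} A {g V} theta i m.

Section WedgeConnections.
Variables (K : fieldType) (A B : cdga K) (g : lieAlgebra K).
Local Notation W := (wedge A B).

Lemma wedge_connected : connected W.
Proof.
split=> [|a]; first exact: oner_neq0.
by exists a; rewrite -[RHS]/(a * 1) mulr1.
Qed.

Definition wedge_inl (i : nat) (a : A i.+1) : W i.+1 := (a, 0).
Definition wedge_inr (i : nat) (b : B i.+1) : W i.+1 := (0, b).
Definition wedge_prl (i : nat) (x : W i.+1) : A i.+1 := x.1.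
Definition wedge_prr (i : nat) (x : W i.+1) : B i.+1 := x.2.

Lemma wedge_inl_linear i : linear (@wedge_inl i).
Proof.
move=> c a b; change ((c *: a + b, 0 : B i.+1) =
  (c *: a + b, c *: (0 : B i.+1) + 0)).
by rewrite scaler0 addr0.
Qed.
HB.instance Definition _ i := GRing.isLinear.Build K (A i.+1) (W i.+1) *:%R
  (@wedge_inl i) (@wedge_inl_linear i).

Lemma wedge_inr_linear i : linear (@wedge_inr i).
Proof.
move=> c a b; change ((0 : A i.+1, c *: a + b) =
  (c *: (0 : A i.+1) + 0, c *: a + b)).
by rewrite scaler0 addr0.
Qed.
HB.instance Definition _ i := GRing.isLinear.Build K (B i.+1) (W i.+1) *:%R
  (@wedge_inr i) (@wedge_inr_linear i).

Lemma wedge_prl_linear i : linear (@wedge_prl i).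
Proof. by []. Qed.
HB.instance Definition _ i := GRing.isLinear.Build K (W i.+1) (A i.+1) *:%R
  (@wedge_prl i) (@wedge_prl_linear i).

Lemma wedge_prr_linear i : linear (@wedge_prr i).
Proof. by []. Qed.
HB.instance Definition _ i := GRing.isLinear.Build K (W i.+1) (B i.+1) *:%R
  (@wedge_prr i) (@wedge_prr_linear i).

(* The pair (w, w') is identified with w + w' through the inclusions of A^1 and
   B^1 in the wedge; wedge_conn_bijective shows that nothing is lost. *)
Definition wedge_conn (p : tensor (A 1%N) g * tensor (B 1%N) g) : tensor (W 1%N) g :=
  tens_map (@wedge_inl 0) idfun p.1 + tens_map (@wedge_inr 0) idfun p.2.

Lemma wedge_conn_linear : linear wedge_conn.
Proof.
by move=> c p q; rewrite /wedge_conn /= !linearP scalerDr addrACA.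
Qed.

Lemma wedge_conn_bijective : bijective wedge_conn.
Proof.
pose pl : {linear tensor (W 1%N) g -> tensor (A 1%N) g} :=
  tens_map (@wedge_prl 0) idfun.
pose pr : {linear tensor (W 1%N) g -> tensor (B 1%N) g} :=
  tens_map (@wedge_prr 0) idfun.
have pll : cancel (tens_map (@wedge_inl 0) idfun) pl.
  apply: (tens_ext (g := pl \o tens_map (@wedge_inl 0) idfun) (h := idfun)).
  by move=> a x; rewrite /= !tens_mapE.
have prr : cancel (tens_map (@wedge_inr 0) idfun) pr.
  apply: (tens_ext (g := pr \o tens_map (@wedge_inr 0) idfun) (h := idfun)).
  by move=> a x; rewrite /= !tens_mapE.
have plr t : pl (tens_map (@wedge_inr 0) idfun t) = 0.
  apply: (tens_ext (g := pl \o tens_map (@wedge_inr 0) idfun) (h := \0)).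
  by move=> a x; rewrite /= !tens_mapE [LHS]linear0l.
have prl t : pr (tens_map (@wedge_inl 0) idfun t) = 0.
  apply: (tens_ext (g := pr \o tens_map (@wedge_inl 0) idfun) (h := \0)).
  by move=> a x; rewrite /= !tens_mapE [LHS]linear0l.
exists (fun t => (pl t, pr t)).
  move=> [s t]; rewrite /wedge_conn; congr (_, _); rewrite linearD /=.
    by rewrite pll plr addr0.
  by rewrite prr prl add0r.
move=> t; rewrite /wedge_conn /=.
apply: (tens_ext (h := idfun)
  (g := (tens_map (@wedge_inl 0) idfun \o pl) \+ (tens_map (@wedge_inr 0) idfun \o pr))).
move=> [a b] x; rewrite /= !tens_mapE -[LHS]linearDl /=; congr tens.
by congr (_, _); rewrite ?addr0 ?add0r.
Qed.


End WedgeConnections.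

(* Main.v *)
Require Import Defs.
From mathcomp Require Import all_boot all_order all_algebra.
From mathcomp Require Import boolp classical_sets reals.
From mathcomp Require Import complex.

Import GRing.Theory.

Local Open Scope ring_scope.
Local Open Scope classical_set_scope.

(** In positive degrees the wedge of A and B is the product of A and B, and a
    flat connection acts on positive degrees by left multiplication with
    elements of degree 1. So, writing w = (wA, wB), the part of positive degree
    of the complex (wedge A B) (x) V twisted by w is the direct sum of the
    corresponding parts of A (x) V twisted by wA and of B (x) V twisted by wB.
    For i > 1 the i-th cohomology involves only degrees i - 1, i and i + 1, all
    positive, hence it is the direct sum of the i-th cohomologies of the two
    factors, and it is nonzero exactly when one of these is. For i = 1 this
    breaks down: the wedge has a single unit, so the coboundaries in degree 1 do
    not split. In the same way the curvature of w is the pair of the curvatures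
    of wA and wB, so w is flat exactly when wA and wB both are.

    The proof organizes this around the two projections from the wedge. They are
    not defined in degree 0, so they are treated as maps of positive degree
    compatible with d and with the products by elements of degree 1, and such a
    map commutes with curvature and with twisted differentials
    (tens_map_curvature, tens_map_twisted_diff). After tensoring they remain
    jointly bijective (tens_pr_bij), and coho_sum_dim_ge1 turns two jointly
    bijective chain maps into the statement on cohomology. *)

Section NonVanishing.
Context {K : fieldType}.

Lemma dim_ge1P (M : lmodType K) : dim_ge M 1 <-> exists x : M, x <> 0.
Proof.
split=> [[e e_free]|[x x_neq0]].
  exists (e ord0) => e0.
  have /eqP : (1 : K) = 0.
    by apply: (e_free (fun=> 1) _ ord0); rewrite big_ord1 e0 scaler0.
  by rewrite oner_eq0.
exists (fun=> x) => c; rewrite big_ord1 => /eqP.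
rewrite scaler_eq0 => /orP[/eqP c0 j|/eqP //].
by rewrite (ord1 j).
Qed.

(** Only whether the quotient is nonzero matters for the resonance varieties of
    depth 1; this form has no quotient and no linear independence left in it. *)
Lemma coho_dim_ge1P (X : nat -> lmodType K) (d : forall i, {linear X i -> X i.+1})
    (n : nat) :
  dim_ge (cohomology d n.+1) 1 <->
  exists x : X n.+1, d n.+1 x = 0 /\ ~ exists y, d n y = x.
Proof.
have piE (z : cocycle d n.+1) :
    \pi_(cohomology d n.+1)%qT z = 0 <-> exists y, d n y = val z.
  have -> : (0 : cohomology d n.+1) = \pi_(cohomology d n.+1)%qT (0 : cocycle d n.+1).
    apply: (addrI (\pi_(cohomology d n.+1)%qT (0 : cocycle d n.+1))).
    by rewrite coho_piD !addr0.
  split=> [/eqP|cob_z].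
    by rewrite -Quotient.idealrBE subr0 => /asboolP.
  by apply/eqP; rewrite -Quotient.idealrBE subr0; apply/asboolP.
split=> [/dim_ge1P[h]|[x [dx0 ncob_x]]].
  elim/quotW: h => z z_neq0; exists (val z); split; first exact/eqP/(valP z).
  by move=> cob_z; apply: z_neq0; apply/piE.
have zx : x \in @cocycle_pred _ _ d n.+1 by rewrite inE dx0 eqxx.
apply/dim_ge1P; exists (\pi_(cohomology d n.+1)%qT (Sub x zx : cocycle d n.+1)).
by move/piE; rewrite SubK.
Qed.

(** The maps p and q present X as the direct sum of Y and Z above degree 0 only,
    which is why the cohomology is taken in degree at least 2: the coboundaries
    there come from degree at least 1. *)
Lemma coho_sum_dim_ge1 (X Y Z : nat -> lmodType K)
    (dX : forall i, {linear X i -> X i.+1})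
    (dY : forall i, {linear Y i -> Y i.+1})
    (dZ : forall i, {linear Z i -> Z i.+1})
    (p : forall n, {linear X n.+1 -> Y n.+1})
    (q : forall n, {linear X n.+1 -> Z n.+1}) (n : nat) :
    (forall m, bijective (fun x => (p m x, q m x))) ->
    (forall m x, p m.+1 (dX m.+1 x) = dY m.+1 (p m x)) ->
    (forall m x, q m.+1 (dX m.+1 x) = dZ m.+1 (q m x)) ->
  dim_ge (cohomology dX n.+2) 1 <->
  dim_ge (cohomology dY n.+2) 1 \/ dim_ge (cohomology dZ n.+2) 1.
Proof.
move=> pq_bij pd qd.
have pq_inj m (x x' : X m.+1) : p m x = p m x' -> q m x = q m x' -> x = x'.
  by move=> px qx; apply: (bij_inj (pq_bij m)); rewrite px qx.
have pq_surj m (y : Y m.+1) (z : Z m.+1) : exists x, p m x = y /\ q m x = z.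
  have [h _ hK] := pq_bij m.
  by exists (h (y, z)); have [-> ->] := hK (y, z).
rewrite !coho_dim_ge1P; split=> [[x [dx0 ncob_x]]|[[y [dy0 ncob_y]]|[z [dz0 ncob_z]]]].
(* If both components of x were coboundaries, then so would be x. *)
- have [[y py]|ncob_px] := pselect (exists y, dY n.+1 y = p n.+1 x).
    right; exists (q n.+1 x); split=> [|[z qz]]; first by rewrite -qd dx0 linear0.
    have [x' [px' qx']] := pq_surj n y z.
    by apply: ncob_x; exists x'; apply: pq_inj; rewrite ?pd ?qd ?px' ?qx'.
  by left; exists (p n.+1 x); split=> //; rewrite -pd dx0 linear0.
- have [x [px qx]] := pq_surj n.+1 y 0.
  exists x; split=> [|[x' dx']].
    by apply: pq_inj; rewrite ?pd ?qd ?px ?qx ?dy0 !linear0.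
  by apply: ncob_y; exists (p n x'); rewrite -pd dx'.
- have [x [px qx]] := pq_surj n.+1 0 z.
  exists x; split=> [|[x' dx']].
    by apply: pq_inj; rewrite ?pd ?qd ?px ?qx ?dz0 !linear0.
  by apply: ncob_z; exists (q n x'); rewrite -qd dx'.
Qed.

End NonVanishing.

(** A family f of maps on the positive degrees compatible with the differential
    and with multiplication by degree 1 elements stands for a morphism of cdga's
    without unit. The projections from a wedge are such, and need not extend to
    degree 0. *)
Section Naturality.
Context {K : fieldType} {C C' : cdga K}.
Variable f : forall n, {linear C n.+1 -> C' n.+1}.
Hypothesis f_diff : forall n (a : C n.+1), f n.+1 (cdiff a) = cdiff (f n a).
Hypothesis f_mul : forall n (a : C 1%N) (b : C n.+1),
  f n.+1 (cmul a b) = cmul (f 0 a) (f n b).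
Context {g : lieAlgebra K}.

Definition curvature {D : cdga K} (w : tensor (D 1%N) g) : tensor (D 2%N) g :=
  conn_diff w + 2^-1 *: (conn_bracket w w : tensor (D 2%N) g).

(** The equation of a flat connection only uses degrees 1 and 2, so f transports
    it; both terms are compared on pure tensors. *)
Lemma tens_map_curvature (w : tensor (C 1%N) g) :
  tens_map (f 1) idfun (curvature w) = curvature (tens_map (f 0) idfun w).
Proof.
have natD (t : tensor (C 1%N) g) :
    tens_map (f 1) idfun (conn_diff t) = conn_diff (tens_map (f 0) idfun t).
  apply: (tens_ext (g := tens_map (f 1) idfun \o @conn_diff _ C g 1)
                   (h := @conn_diff _ C' g 1 \o tens_map (f 0) idfun)).
  by move=> a x; rewrite /= /conn_diff !tens_mapE /= f_diff.
pose F0 : {linear tensor (C 1%N) g -> tensor (C' 1%N) g} := tens_map (f 0) idfun.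
pose F1 : {linear tensor (C 2%N) g -> tensor (C' 2%N) g} := tens_map (f 1) idfun.
have natB (s t : tensor (C 1%N) g) :
    F1 (conn_bracket s t : tensor (C 2%N) g) = conn_bracket (F0 s) (F0 t).
  rewrite [s]tensorE [t]tensorE; move: (repr s) (repr t) => {s t} s t.
  rewrite !(linear_sum F0).
  rewrite [X in F1 X]linear_sumlz (linear_sum F1) [RHS]linear_sumlz.
  apply: eq_bigr => p _.
  rewrite [X in F1 X]linear_sumr (linear_sum F1) [RHS]linear_sumr.
  apply: eq_bigr => q _.
  by rewrite /= conn_bracketE /F0 /F1 !tens_mapE conn_bracketE /= f_mul.
rewrite /curvature linearD linearZ /= natD; congr (_ + _ *: _).
exact: natB.
Qed.

(** Naturality in both the connection and the argument. Degree 0 of the argument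
    is left out: the connection of the wedge multiplies 1 into both factors. *)
Lemma tens_map_twisted_diff (V : vectType K) (theta : lieRep g V)
    (w : tensor (C 1%N) g) (n : nat) (t : tensor (C n.+1) V) :
  tens_map (f n.+1) idfun (twisted_diff theta w t) =
  twisted_diff theta (tens_map (f 0) idfun w) (tens_map (f n) idfun t).
Proof.
apply: (tens_ext (g := tens_map (f n.+1) idfun \o @twisted_diff _ C g V theta w n.+1)
  (h := @twisted_diff _ C' g V theta (tens_map (f 0) idfun w) n.+1
          \o tens_map (f n) idfun)) => a v /=.
have wE := tensorE w; move: (repr w) wE => r wE.
(* Both sides are expanded along one and the same decomposition of w into pure
   tensors. *)
have fwE : tens_map (f 0) idfun w =
    \sum_(p <- [seq (f 0 q.1, q.2) | q <- r]) tens p.1 p.2.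
  by rewrite wE linear_sum big_map; apply: eq_bigr => p _ /=; rewrite tens_mapE.
rewrite tens_mapE (twisted_diffE _ _ _ wE) (twisted_diffE _ _ _ fwE).
rewrite linearD linear_sum big_map /= tens_mapE f_diff; congr (_ + _).
by apply: eq_bigr => p _; rewrite tens_mapE f_mul.
Qed.

End Naturality.

Section WedgeProduct.
Context {K : fieldType} {A B : cdga K}.
Local Notation W := (wedge A B).

Definition tens_prl (N : lmodType K) (n : nat) :
  {linear tensor (W n.+1) N -> tensor (A n.+1) N} := tens_map (@wedge_prl _ A B n) idfun.
Definition tens_prr (N : lmodType K) (n : nat) :
  {linear tensor (W n.+1) N -> tensor (B n.+1) N} := tens_map (@wedge_prr _ A B n) idfun.

(** In degree 1 with N the Lie algebra, this is convertible to wedge_conn. *)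
Definition tens_pair (N : lmodType K) (n : nat)
    (p : tensor (A n.+1) N * tensor (B n.+1) N) : tensor (W n.+1) N :=
  tens_map (@wedge_inl _ A B n) idfun p.1 + tens_map (@wedge_inr _ A B n) idfun p.2.

Lemma tens_pairK (N : lmodType K) (n : nat) :
  cancel (@tens_pair N n) (fun t => (tens_prl N n t, tens_prr N n t)).
Proof.
have pll : cancel (tens_map (@wedge_inl _ A B n) idfun) (tens_prl N n).
  apply: (tens_ext (g := tens_prl N n \o tens_map (@wedge_inl _ A B n) idfun) (h := idfun)).
  by move=> a x; rewrite /= !tens_mapE.
have prr : cancel (tens_map (@wedge_inr _ A B n) idfun) (tens_prr N n).
  apply: (tens_ext (g := tens_prr N n \o tens_map (@wedge_inr _ A B n) idfun) (h := idfun)).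
  by move=> a x; rewrite /= !tens_mapE.
have plr t : tens_prl N n (tens_map (@wedge_inr _ A B n) idfun t) = 0.
  apply: (tens_ext (g := tens_prl N n \o tens_map (@wedge_inr _ A B n) idfun) (h := \0)).
  by move=> a x; rewrite /= !tens_mapE [LHS]linear0l.
have prl t : tens_prr N n (tens_map (@wedge_inl _ A B n) idfun t) = 0.
  apply: (tens_ext (g := tens_prr N n \o tens_map (@wedge_inl _ A B n) idfun) (h := \0)).
  by move=> a x; rewrite /= !tens_mapE [LHS]linear0l.
by move=> [s t]; rewrite /tens_pair !linearD /= pll prr plr prl addr0 add0r.
Qed.

Lemma tens_prK (N : lmodType K) (n : nat) :
  cancel (fun t => (tens_prl N n t, tens_prr N n t)) (@tens_pair N n).
Proof.
apply: (tens_ext (h := idfun)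
  (g := (tens_map (@wedge_inl _ A B n) idfun \o tens_prl N n) \+
        (tens_map (@wedge_inr _ A B n) idfun \o tens_prr N n))).
move=> [a b] x; rewrite /= !tens_mapE -[LHS]linearDl /=; congr tens.
by congr (_, _); rewrite ?addr0 ?add0r.
Qed.

(** The tensor product distributes over the direct sum that the wedge is in
    positive degree. *)
Lemma tens_pr_bij (N : lmodType K) (n : nat) :
  bijective (fun t => (tens_prl N n t, tens_prr N n t)).
Proof. exact: Bijective (@tens_prK N n) (@tens_pairK N n). Qed.

Variable g : lieAlgebra K.

(** The curvature of w lives in degree 2 of the wedge, where it is determined by
    its two projections; these are the curvatures of the projections of w. *)
Lemma wedge_flatP (w : tensor (W 1%N) g) :
  flat_connections W g w <->
  flat_connections A g (tens_prl g 0 w) /\ flat_connections B g (tens_prr g 0 w).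
Proof.
have curvl : tens_prl g 1 (curvature w) = curvature (tens_prl g 0 w).
  exact: tens_map_curvature.
have curvr : tens_prr g 1 (curvature w) = curvature (tens_prr g 0 w).
  exact: tens_map_curvature.
rewrite -![flat_connections _ _ _]/(curvature _ = 0) -curvl -curvr.
split=> [->|[cl0 cr0]]; first by rewrite !linear0.
by apply: (bij_inj (tens_pr_bij g 1)); rewrite cl0 cr0 !linear0.
Qed.

(** Flatness of w gives flatness of both components, so in each case of the
    union the component not required to be resonant is still flat. *)
Lemma wedge_resonance1P (V : vectType K) (theta : lieRep g V) (n : nat)
    (w : tensor (W 1%N) g) :
  resonance W theta n.+2 1 w <->
  (resonance A theta n.+2 1 (tens_prl g 0 w) /\
    flat_connections B g (tens_prr g 0 w)) \/
  (flat_connections A g (tens_prl g 0 w) /\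
    resonance B theta n.+2 1 (tens_prr g 0 w)).
Proof.
have cohoP :
    dim_ge (cohomology
      (fun m => @twisted_diff _ W _ _ theta w m : {linear _ -> _}) n.+2) 1 <->
    dim_ge (cohomology
      (fun m => @twisted_diff _ A _ _ theta (tens_prl g 0 w) m : {linear _ -> _}) n.+2) 1 \/
    dim_ge (cohomology
      (fun m => @twisted_diff _ B _ _ theta (tens_prr g 0 w) m : {linear _ -> _}) n.+2) 1.
  apply: (@coho_sum_dim_ge1 _ (fun m => tensor (W m) V) (fun m => tensor (A m) V)
    (fun m => tensor (B m) V) _ _ _ (tens_prl V) (tens_prr V)) => m.
  - exact: tens_pr_bij.
  - by move=> t; apply: tens_map_twisted_diff.
  - by move=> t; apply: tens_map_twisted_diff.
rewrite /resonance /= cohoP wedge_flatP; tauto.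
Qed.

End WedgeProduct.

Theorem corollary5 (R : realType) (A B : cdga R[i])
    (hA : connected A) (hB : connected B)
    (fA : finite_type_low A) (fB : finite_type_low B)
    (g : lieAlgebra R[i]) (i : nat) (hi : (1 < i)%N)
    (V : vectType R[i]) (hV : (0 < \dim {:V})%N) (theta : lieRep g V) :
  resonance (wedge A B) theta i 1 =
  @wedge_conn _ A B g @`
    ((resonance A theta i 1 `*` flat_connections B g) `|`
     (flat_connections A g `*` resonance B theta i 1)).
Proof.
case: i hi => [|[|n]] // _; apply/seteqP; split=> [w /wedge_resonance1P w_res|w].
  by exists (tens_prl g 0 w, tens_prr g 0 w); last exact: (tens_prK _ _ w).
move=> [[s t] st_res <-]; apply/wedge_resonance1P.
rewrite -[wedge_conn _]/(tens_pair g 0 (s, t)).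
rewrite (congr1 fst (tens_pairK g 0 (s, t)) : tens_prl g 0 _ = s).
by rewrite (congr1 snd (tens_pairK g 0 (s, t)) : tens_prr g 0 _ = t).
Qed.
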